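(* Let $\mathbf{x}(s)$, $s\in I$, be a multiplicative biregular curve in $\mathbb{E}_*^3$ parametrized by multiplicative arc length, with multiplicative curvature $\kappa>0_*$, and let $\rho(s)=\|\mathbf{x}(s)\|_*$ be its multiplicative distance function. If $\mathbf{x}$ is a multiplicative rectifying curve, then there are $c,d\in\mathbb{R}$ with $d>0$ such that for all $s\in I$ $$\rho(s)^{2_*}=s^{2_*}+_*e^c\cdot_*s+_*e^d,$$ or equivalently $e^{(\log\rho(s))^2}=e^{(\log s)^2+c\log s+d}$. Conversely, if there are $c,d\in\mathbb{R}$, $d>0$, such that this identity holds for all $s\in I$, then $\mathbf{x}$ is a multiplicative rectifying curve.
   Context: Multiplicative arithmetic. $\mathbb{R}_*$ is the set of positive reals with the field operations $a+_*b=e^{\log a+\log b}$, $a-_*b=e^{\log a-\log b}$, $a\cdot_*b=e^{\log a\log b}$, $a/_*b=e^{\log a/\log b}$ ($b\ne1$); $0_*=1$, $1_*=e$; $>$ is the usual order. Also $a^{2_*}=e^{(\log a)^2}$ and $a^{\frac12_*}=e^{\sqrt{\log a}}$ (for $a\ge 1$). Multiplicative derivative. For $f:I\to\mathbb{R}_*$, $I\subset\mathbb{R}_*$ an interval, $f^*(s)=\lim_{h\to1}(f(s+_*h)-_*f(s))/_*h=e^{s(\log f(s))'}$, with $'$ the usual derivative. All functions are multiplicative differentiable to whatever order is needed. For vector-valued functions the derivative is taken componentwise. Multiplicative Euclidean space. $\mathbb{E}_*^3$ is $\mathbb{R}_*^3$ with $\mathbf{x}+_*\mathbf{y}=(x_iy_i)_i$,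 $a\cdot_*\mathbf{x}=(e^{\log a\log x_i})_i$, zero vector $\mathbf{0}_*=(1,1,1)$, inner product $\langle\mathbf{x},\mathbf{y}\rangle_*=e^{\sum_i\log x_i\log y_i}$, norm $\|\mathbf{x}\|_*=\langle\mathbf{x},\mathbf{x}\rangle_*^{\frac12_*}=e^{\sqrt{\sum_i(\log x_i)^2}}$. Cross product: $\mathbf{x}\times_*\mathbf{y}=(e^{\log x_2\log y_3-\log x_3\log y_2},e^{\log x_3\log y_1-\log x_1\log y_3},e^{\log x_1\log y_2-\log x_2\log y_1})$. Vectors are multiplicative collinear iff their cross product is $\mathbf{0}_*$. Subtraction of vectors and scalar division $\mathbf{x}/_*a$ are componentwise. Curves. $\mathbf{x}:I\to\mathbb{E}_*^3$ is parametrized by multiplicative arc length if $\|\mathbf{x}^*(s)\|_*=1_*$ for all $s$; it is multiplicative biregular if $\mathbf{x}^*(s)$ and $\mathbf{x}^{**}(s)$ are nowhere multiplicative collinear. The multiplicative Frenet frame of a biregular arc length parametrized curve is $\mathbf{t}=\mathbf{x}^*$, $\mathbf{n}=\mathbf{x}^{**}/_*\|\mathbf{x}^{**}\|_*$, $\mathbf{b}=\mathbf{t}\times_*\mathbf{n}$. The multiplicative curvature is $\kappa=\|\mathbf{x}^{**}\|_*$. A multiplicative biregular curve $\mathbf{x}$ is a multiplicative rectifying curve if $\langle\mathbf{x}(s),\mathbf{n}(s)\rangle_*=0_*$ for every $s\in I$. *)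

(* Defs.v *)
From HB Require Import structures.
From mathcomp Require Import all_boot all_order all_algebra.
From mathcomp Require Import all_classical all_reals all_analysis.
Set Implicit Arguments.
Unset Strict Implicit.
Unset Printing Implicit Defensive.
Import Order.TTheory GRing.Theory Num.Theory.
Import numFieldNormedType.Exports.
Local Open Scope classical_set_scope.
Local Open Scope ring_scope.

(* The multiplicative reals are the positive elements of R: they are handled
   as elements of R, and positivity is assumed of the data (interval, curve).
   The operations below take positive values only. *)

Section MultiplicativeArithmetic.
Context {R : realType}.
Implicit Types a b : R.

Definition star0 : R := 1.
Definition star1 : R := expR 1.
Definition madd a b : R := expR (ln a + ln b).
Definition msub a b : R := expR (ln a - ln b).
Definition mmul a b : R := expR (ln a * ln b).
Definition mdiv a b : R := expR (ln a / ln b).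
Definition msqr a : R := expR (ln a ^+ 2).
Definition msqrt a : R := expR (Num.sqrt (ln a)).

End MultiplicativeArithmetic.

Section MultiplicativeDerivative.
Context {R : realType}.
Implicit Types (I : set R) (f : R -> R) (s h : R) (n : nat).

Definition mquotient f s h : R := mdiv (msub (f (madd s h)) (f s)) h.

(* h tends to 1 with h <> 1 and s +* h in I, so that the limit is one-sided
   at an endpoint of I that belongs to I. *)
Definition mincrements I s : set_system R :=
  within [set h | I (madd s h)] star0^'.

Definition mderiv I f s : R := lim (mquotient f s @ mincrements I s).

(* The limit has to lie in the multiplicative reals, hence to be positive:
   a quotient tending to 0 in R does not converge there. *)
Definition mderivable I f s : Prop :=
  exists2 l : R, 0 < l & mquotient f s @ mincrements I s --> l.

Definition mderivable_n n I f : Prop :=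
  forall k, (k < n)%N -> forall s, I s -> mderivable I (iter k (mderiv I) f) s.

End MultiplicativeDerivative.

Section MultiplicativeSpace.
Context {R : realType}.
Implicit Types (x y : 'rV[R]_3) (a : R).

Definition mvzero : 'rV[R]_3 := const_mx star0.

Definition mvdiv x a : 'rV[R]_3 := map_mx (fun xi => mdiv xi a) x.

Definition minner x y : R := expR (\sum_(i < 3) ln (x 0 i) * ln (y 0 i)).

Definition mnorm x : R := msqrt (minner x x).

Definition mcross x y : 'rV[R]_3 := \row_(i < 3)
  [:: expR (ln (x 0 1) * ln (y 0 2) - ln (x 0 2) * ln (y 0 1));
      expR (ln (x 0 2) * ln (y 0 0) - ln (x 0 0) * ln (y 0 2));
      expR (ln (x 0 0) * ln (y 0 1) - ln (x 0 1) * ln (y 0 0))]`_i.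

Definition mcollinear x y : Prop := mcross x y = mvzero.

End MultiplicativeSpace.

Section MultiplicativeCurves.
Context {R : realType}.
Implicit Types (I : set R) (x : R -> 'rV[R]_3) (s : R).

Definition mvderiv I x s : 'rV[R]_3 :=
  \row_(i < 3) mderiv I (fun u => x u 0 i) s.

Definition arc_length_parametrized I x : Prop :=
  forall s, I s -> mnorm (mvderiv I x s) = star1.

Definition mbiregular I x : Prop :=
  forall s, I s -> ~ mcollinear (mvderiv I x s) (mvderiv I (mvderiv I x) s).

Definition mcurvature I x s : R := mnorm (mvderiv I (mvderiv I x) s).

Definition mnormal I x s : 'rV[R]_3 :=
  mvdiv (mvderiv I (mvderiv I x) s) (mnorm (mvderiv I (mvderiv I x) s)).

Definition mdistance x s : R := mnorm (x s).

Definition mrectifying I x : Prop :=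
  forall s, I s -> minner (x s) (mnormal I x s) = star0.

End MultiplicativeCurves.

(* Main.v *)
(* In the coordinates u = log s, y_i = log x_i the multiplicative geometry is the
   Euclidean one: y has unit speed and x is rectifying iff <y, y''> = 0.  Since
   <y, y'>' = 1 + <y, y''> and (|y|^2)' = 2 <y, y'>, this amounts to
   |y|^2 = u^2 + c u + d.  With c = 2k, the component of y normal to y' has
   constant squared length d - k^2; if d <= 0 this forces k = d = 0, so that
   y = u y', and differentiating gives u y'' = 0, against positive curvature.
   This replaces the binormal component <y, b> of the usual argument, whose
   differentiability would need a third derivative of the curve. *)

Require Import Defs.
From HB Require Import structures.
From mathcomp Require Import all_boot all_order all_algebra.
From mathcomp Require Import all_classical all_reals all_analysis.
From mathcomp Require Import ring lra.
Set Implicit Arguments.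
Unset Strict Implicit.
Unset Printing Implicit Defensive.
Import Order.TTheory GRing.Theory Num.Theory.
Import numFieldNormedType.Exports.
Local Open Scope classical_set_scope.
Local Open Scope ring_scope.

(** * Differential calculus relative to an interval *)

Section DerivativeWithin.
Context {R : realType}.
Implicit Types (J : set R) (f g : R -> R) (u v l m : R).

(** Rules out one-point intervals, on which the punctured filter is trivial and limits are not
    unique. *)
Definition nondegenerate J := exists a b, [/\ J a, J b & a < b].

(* One-sided at an endpoint of J that belongs to J. *)
Definition deriv_within J f u l : Prop :=
  (f v - f u) / (v - u) @[v --> within J u^'] --> l.

Lemma deriv_within_ext J f g u l : J u -> (forall v, J v -> f v = g v) ->
  deriv_within J f u l -> deriv_within J g u l.
Proof.
move=> Ju fg; apply: cvg_trans; apply: near_eq_cvg.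
by apply: filterS (withinT J _) => v Jv; rewrite !fg.
Qed.

Lemma deriv_within_cst J (k : R) u : deriv_within J (fun=> k) u 0.
Proof.
rewrite /deriv_within; under eq_fun do rewrite subrr mul0r.
exact: cvg_cst.
Qed.

Lemma near_within_dnbhs_neq J u : \forall v \near within J u^', v - u != 0.
Proof. by apply: filterS (nbhs_dnbhs_neq u) => v; rewrite subr_eq0. Qed.

Lemma deriv_within_id J u : deriv_within J id u 1.
Proof.
have h : 1 @[_ --> within J u^'] --> (1 : R) by exact: cvg_cst.
apply: cvg_trans h; apply: near_eq_cvg.
by apply: filterS (near_within_dnbhs_neq J u) => v vu; rewrite divff.
Qed.

Lemma cvg_within_dnbhs J u : v @[v --> within J u^'] --> u.
Proof.
by apply: cvg_trans (@nbhs_dnbhs _ u); exact: cvg_within.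
Qed.

Lemma deriv_within_cvg J f u l : deriv_within J f u l ->
  f v @[v --> within J u^'] --> f u.
Proof.
move=> fl.
have h : (f v - f u) / (v - u) * (v - u) + f u @[v --> within J u^'] --> f u.
  rewrite -[X in _ --> X]add0r -[X in _ --> X + _](mulr0 l).
  apply: cvgD; last exact: cvg_cst.
  apply: cvgM => //; rewrite -[X in _ --> X](subrr u).
  by apply: cvgB; [exact: cvg_within_dnbhs|exact: cvg_cst].
apply: cvg_trans h; apply: near_eq_cvg.
by apply: filterS (near_within_dnbhs_neq J u) => v vu; rewrite divfK ?subrK.
Qed.

Lemma deriv_withinD J f g u l m :
  deriv_within J f u l -> deriv_within J g u m ->
  deriv_within J (fun v => f v + g v) u (l + m).
Proof.
move=> fl gm; apply: cvg_trans (cvgD fl gm); apply: near_eq_cvg.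
by apply: nearW => v /=; rewrite fctE -mulrDl opprD addrACA.
Qed.

Lemma deriv_withinM J f g u l m :
  deriv_within J f u l -> deriv_within J g u m ->
  deriv_within J (fun v => f v * g v) u (l * g u + f u * m).
Proof.
move=> fl gm.
have fc := deriv_within_cvg fl.
(* In this splitting [f v] still varies, so its limit [f u] comes from the continuity of [f]. *)
have h : (f v - f u) / (v - u) * g u + f v * ((g v - g u) / (v - u))
    @[v --> within J u^'] --> l * g u + f u * m.
  by apply: cvgD; apply: cvgM => //; exact: cvg_cst.
by apply: cvg_trans h; apply: near_eq_cvg; apply: nearW => v; ring.
Qed.

Lemma deriv_within_sum J n (f : 'I_n -> R -> R) u (l : 'I_n -> R) :
  (forall i, deriv_within J (f i) u (l i)) ->
  deriv_within J (fun v => \sum_i f i v) u (\sum_i l i).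
Proof.
move=> fl; elim: n f l fl => [|n ih] f l fl.
  rewrite big_ord0; under eq_fun do rewrite big_ord0.
  exact: deriv_within_cst.
rewrite big_ord_recl; under eq_fun do rewrite big_ord_recl.
by apply: deriv_withinD => //; exact: ih.
Qed.

(** Some point [w] of [J] differs from [u]. Clipping [w] to distance at most [e / 2] from [u] keeps
    it between [w] and [u], hence in [J]. Properness is what makes derivatives unique. *)
Lemma within_dnbhs_proper J u : is_interval J -> nondegenerate J -> J u ->
  ProperFilter (within J u^').
Proof.
move=> Jitv [a [b [Ja Jb ab]]] Ju; apply: Build_ProperFilter_ex => P.
have [w [Jw wu]] : exists w, J w /\ w != u.
  case: (eqVneq a u) => [<-|au]; last by exists a.
  by exists b; split=> //; rewrite gt_eqF.
rewrite /within /= /dnbhs /within /= => -[e /= e0 eP].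
have e2 : 0 < e / 2 by lra.
case: (ltgtP w u) wu => // [wu|uw] _.
- exists (Num.max w (u - e / 2)); apply: eP; rewrite /ball_ /=.
  + rewrite ger0_norm; last by rewrite subr_ge0 ge_max ltW//=; lra.
    have : u - e / 2 <= Num.max w (u - e / 2) by rewrite le_max lexx orbT.
    by lra.
  + by rewrite lt_eqF// gt_max wu/=; lra.
  + by apply: (Jitv w u) => //; rewrite le_max lexx/= ge_max ltW//=; lra.
- exists (Num.min w (u + e / 2)); apply: eP; rewrite /ball_ /=.
  + rewrite ler0_norm; last by rewrite subr_le0 le_min ltW//=; lra.
    have : Num.min w (u + e / 2) <= u + e / 2 by rewrite ge_min lexx orbT.
    by lra.
  + by rewrite gt_eqF// lt_min uw/=; lra.
  + by apply: (Jitv u w) => //; rewrite ge_min lexx/= le_min (ltW uw)/=; lra.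
Qed.

Lemma deriv_within_unique J f u l m : is_interval J -> nondegenerate J ->
  J u -> deriv_within J f u l -> deriv_within J f u m -> l = m.
Proof.
move=> Jitv Jnd Ju; have FF := within_dnbhs_proper Jitv Jnd Ju.
exact: cvg_unique.
Qed.

(** At an interior point all small increments stay in [J], so the restriction to [J] disappears.
    This is the form of derivative that the mean value theorem takes. *)
Lemma deriv_within_interior J f u l : nbhs u J -> deriv_within J f u l ->
  is_derive u 1 f l.
Proof.
move=> uJ fl.
have h : (f (h + u) - f u) / (h + u - u) @[h --> 0^'] --> l.
  apply: cvg_comp fl => P /=.
  rewrite /within /dnbhs /= => -[e /= e0 eP].
  have /nbhs_ballP[d /= d0 dJ] := uJ.
  exists (Num.min e d); first by rewrite /= lt_min e0.
  move=> h /=; rewrite sub0r normrN lt_min => /andP[he hd] h0.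
  have uh : `|u - (h + u)| = `|h| by rewrite opprD addrCA subrr addr0 normrN.
  apply: eP; rewrite /ball_ /= ?uh//; first by rewrite -subr_eq0 addrK.
  by apply: dJ; rewrite /ball /= uh.
have h' : h^-1 *: ((f \o shift u) (h *: 1) - f u) @[h --> 0^'] --> l.
  apply: cvg_trans h; apply: near_eq_cvg; apply: nearW => h /=.
  by rewrite /GRing.scale /= mulr1 addrK mulrC.
apply: DeriveDef; last exact: cvg_lim h'.
by apply/cvg_ex; exists l.
Qed.

(** The point [u] is put back into the punctured filter, which gives continuity on the subspace
    [J]. *)
Lemma deriv_within_continuous J f u l : deriv_within J f u l ->
  f v @[v --> within J (nbhs u)] --> f u.
Proof.
move=> /deriv_within_cvg fu; apply/cvgrPdist_lt => e e0.
move/cvgrPdist_lt : fu => /(_ _ e0).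
rewrite /dnbhs !near_withinE; apply: filterS => v h Jv.
by have [->|vu] := eqVneq v u; [rewrite subrr normr0|exact: h].
Qed.

(** Mean value theorem between [u] and [v]: the points strictly between them are interior to [J],
    and continuity up to the ends follows from the one-sided derivatives. *)
Lemma deriv_within_eq0_cst J f : is_interval J ->
  (forall u, J u -> deriv_within J f u 0) ->
  forall u v, J u -> J v -> f u = f v.
Proof.
move=> Jitv df.
suff wlt u v : J u -> J v -> u < v -> f u = f v.
  by move=> u v Ju Jv; have [uv|vu|->//] := ltgtP u v; [exact: wlt|rewrite (wlt v u)].
move=> Ju Jv uv.
have uvJ w : u <= w <= v -> J w by exact: Jitv.
have [||c _] := @MVT_segment R f (fun=> 0) u v (ltW uv).
- move=> w; rewrite in_itv /= => wuv; apply: (@deriv_within_interior J).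
    apply: filterS (near_in_itvoo wuv) => z; rewrite in_itv /= => /andP[uz zv].
    by apply: uvJ; rewrite !ltW.
  by case/andP: wuv => uw wv; apply: df; apply: uvJ; rewrite !ltW.
- apply: (@continuous_subspaceW _ _ _ J) => [w|].
    by rewrite /= in_itv /=; exact: uvJ.
  by apply/subspace_continuousP => w /df /deriv_within_continuous.
by rewrite mul0r => /eqP; rewrite subr_eq0 => /eqP ->.
Qed.

End DerivativeWithin.

(** * Unit speed curves in Euclidean space *)

Section EuclideanRectifying.
Context {R : realType}.
Implicit Types (J : set R) (u c d : R).

Definition dot n (f g : 'I_n -> R -> R) u : R := \sum_i f i u * g i u.

Lemma dotC n (f g : 'I_n -> R -> R) u : dot f g u = dot g f u.
Proof. by apply: eq_bigr => i _; rewrite mulrC. Qed.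

Lemma deriv_within_dot J n (f g f1 g1 : 'I_n -> R -> R) u :
  (forall i, deriv_within J (f i) u (f1 i u)) ->
  (forall i, deriv_within J (g i) u (g1 i u)) ->
  deriv_within J (dot f g) u (dot f1 g u + dot f g1 u).
Proof.
move=> ff1 gg1; rewrite -big_split /=.
by apply: deriv_within_sum => i; exact: deriv_withinM.
Qed.

Lemma deriv_within_quadratic J c d u :
  deriv_within J (fun v => v ^+ 2 + c * v + d) u (2 * u + c).
Proof.
(* The polynomial is differentiated in the form [v * (v + c) + d]. *)
have h := deriv_withinM (deriv_within_id J u)
  (deriv_withinD (deriv_within_id J u) (deriv_within_cst J c u)).
have := deriv_withinD h (deriv_within_cst J d u).
rewrite (_ : _ + 0 = 2 * u + c); last by ring.
by congr (deriv_within _ _ _ _); apply/funext => v; ring.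
Qed.

Context (J : set R) (n : nat) (y y1 y2 : 'I_n -> R -> R).
Context (Jitv : is_interval J) (Jnd : nondegenerate J).
Context (yy1 : forall u, J u -> forall i, deriv_within J (y i) u (y1 i u)).
Context (y1y2 : forall u, J u -> forall i, deriv_within J (y1 i) u (y2 i u)).
Context (y1_unit : forall u, J u -> dot y1 y1 u = 1).

Lemma deriv_within_dot_position u : J u ->
  deriv_within J (dot y y) u (2 * dot y y1 u).
Proof.
move=> Ju; have := deriv_within_dot (yy1 Ju) (yy1 Ju).
by rewrite dotC -mulr2n mulr_natl.
Qed.

Lemma deriv_within_dot_tangent u : J u ->
  deriv_within J (dot y y1) u (1 + dot y y2 u).
Proof.
by move=> Ju; have := deriv_within_dot (yy1 Ju) (y1y2 Ju); rewrite y1_unit.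
Qed.

Lemma rectifying_dot_quadratic :
  (forall u, J u -> dot y2 y2 u != 0) ->
  (forall u, J u -> dot y y2 u = 0) ->
  exists c d, 0 < d /\ forall u, J u -> dot y y u = u ^+ 2 + c * u + d.
Proof.
move=> y2_neq0 yy2; have [a [b [Ja Jb ab]]] := Jnd.
(* First integration: [dot y y1] has derivative 1, and [k] is the constant read off at [a]. *)
have [k yy1E] : exists k, forall u, J u -> dot y y1 u = u + k.
  exists (dot y y1 a - a) => u Ju.
  pose f v := dot y y1 v + v * -1.
  suff : f u = f a by rewrite /f; lra.
  apply: (deriv_within_eq0_cst Jitv) => // v Jv.
  rewrite (_ : 0 = (1 + dot y y2 v) + (1 * -1 + v * 0)); last first.
    by rewrite yy2//; ring.
  apply: deriv_withinD; first exact: deriv_within_dot_tangent.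
  exact: (deriv_withinM (deriv_within_id J v) (deriv_within_cst J (-1) v)).
(* Second integration: [dot y y] has derivative [2 * (u + k)]. *)
have [d yyE] : exists d, forall u, J u -> dot y y u = u ^+ 2 + 2 * k * u + d.
  exists (dot y y a - (a ^+ 2 + 2 * k * a)) => u Ju.
  pose f v := dot y y v + (-1) * (v ^+ 2 + 2 * k * v + 0).
  suff : f u = f a by rewrite /f; lra.
  apply: (deriv_within_eq0_cst Jitv) => // v Jv.
  rewrite (_ : 0 = 2 * dot y y1 v + (0 * (v ^+ 2 + 2 * k * v + 0)
                                     + (-1) * (2 * v + 2 * k))); last first.
    by rewrite yy1E//; ring.
  apply: deriv_withinD; first exact: deriv_within_dot_position.
  exact: (deriv_withinM (deriv_within_cst J (-1) v)
                        (@deriv_within_quadratic J (2 * k) 0 v)).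
exists (2 * k), d; split => //.
(* Since [u + k] is the tangential coefficient [dot y y1 u], the sum is the squared length of the
   component of [y] normal to [y1]. *)
have normalE u : J u -> \sum_i (y i u - (u + k) * y1 i u) ^+ 2 = d - k ^+ 2.
  move=> Ju.
  have -> : \sum_i (y i u - (u + k) * y1 i u) ^+ 2 =
      dot y y u - 2 * (u + k) * dot y y1 u + (u + k) ^+ 2 * dot y1 y1 u.
    rewrite /dot !mulr_sumr -sumrB -big_split /=.
    by apply: eq_bigr => i _; ring.
  by rewrite yyE// yy1E// y1_unit//; ring.
have normal_ge0 u : 0 <= \sum_i (y i u - (u + k) * y1 i u) ^+ 2.
  by apply: sumr_ge0 => i _; exact: sqr_ge0.
(* If [d <= 0], then [k ^+ 2 <= d] forces [k = d = 0], and the normal component vanishes. *)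
rewrite ltNge; apply/negP => d_le0.
have k2d : k ^+ 2 <= d by rewrite -subr_ge0 -(normalE a)// normal_ge0.
have k2_ge0 := sqr_ge0 k.
have k0 : k = 0 by apply/eqP; rewrite -sqrf_eq0; apply/eqP; lra.
have yE i u : J u -> y i u = u * y1 i u.
  move=> Ju; apply/eqP; rewrite -subr_eq0 -sqrf_eq0.
  have /eqP : \sum_i (y i u - (u + k) * y1 i u) ^+ 2 = 0.
    by rewrite normalE//; lra.
  rewrite psumr_eq0 => [/allP /(_ i (mem_index_enum i)) /=|j _].
    by rewrite k0 addr0.
  exact: sqr_ge0.
(* Differentiating [y = u * y1] gives [y1 = y1 + u * y2]. *)
have uy2 i u : J u -> u * y2 i u = 0.
  move=> Ju.
  have h : deriv_within J (fun v => v * y1 i v) u (1 * y1 i u + u * y2 i u).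
    by apply: deriv_withinM; [exact: deriv_within_id|exact: y1y2].
  have h1 : deriv_within J (fun v => v * y1 i v) u (y1 i u).
    by apply: (@deriv_within_ext _ _ (y i)) => [//|v|]; [exact: yE|exact: yy1].
  by have := deriv_within_unique Jitv Jnd Ju h h1; lra.
(* One of the two points [a < b] is nonzero; there [y2] vanishes, a contradiction. *)
have [u [Ju u0]] : exists u, J u /\ u != 0.
  by have [a0|] := eqVneq a 0; [exists b; rewrite gt_eqF// -a0|exists a].
case/negP: (y2_neq0 u Ju); apply/eqP; apply: big1 => i _.
by move/eqP: (uy2 i u Ju); rewrite mulf_eq0 (negbTE u0) => /eqP ->; rewrite mul0r.
Qed.

(** Differentiating the identity once gives [dot y y1 u = u + c / 2]; differentiating again gives
    [1 + dot y y2 u = 1]. *)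
Lemma dot_quadratic_rectifying c d :
  (forall u, J u -> dot y y u = u ^+ 2 + c * u + d) ->
  forall u, J u -> dot y y2 u = 0.
Proof.
move=> yyE.
have yy1E u : J u -> u + c / 2 = dot y y1 u.
  move=> Ju.
  suff : 2 * dot y y1 u = 2 * u + c by lra.
  apply: (deriv_within_unique Jitv Jnd Ju (deriv_within_dot_position Ju)).
  apply: (deriv_within_ext Ju _ (@deriv_within_quadratic J c d u)).
  by move=> v /yyE.
move=> u Ju; apply: (@addrI _ 1); rewrite addr0.
apply: (deriv_within_unique Jitv Jnd Ju (deriv_within_dot_tangent Ju)).
apply: (@deriv_within_ext _ _ (fun v => v + c / 2)) => //.
rewrite -[X in deriv_within _ _ _ X]addr0.
exact: deriv_withinD (deriv_within_id J u) (@deriv_within_cst _ J (c / 2) u).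
Qed.

End EuclideanRectifying.

(** * From multiplicative to ordinary derivatives *)

Section LogarithmicCoordinates.
Context {R : realType} (I : set R).
Context (I_itv : is_interval I) (I_nondegenerate : nondegenerate I).
Context (I_pos : forall s, I s -> 0 < s).

Definition log_domain : set R := [set u | I (expR u)].

Lemma log_domain_interval : is_interval log_domain.
Proof.
by move=> u v Iu Iv w uwv; apply: (I_itv Iu Iv); rewrite !ler_expR.
Qed.

Lemma log_domain_ln s : I s -> log_domain (ln s).
Proof. by move=> Is; rewrite /log_domain /= lnK// posrE I_pos. Qed.

Lemma log_domain_nondegenerate : nondegenerate log_domain.
Proof.
have [a [b [Ia Ib ab]]] := I_nondegenerate.
exists (ln a), (ln b); split; try exact: log_domain_ln.
by rewrite ltr_ln// posrE I_pos.
Qed.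

(** The multiplicative increment leading from [expR u] to [expR v] is [h = expR (v - u)], and [h]
    differs from 1 exactly when [v] differs from [u]. Limits in [h] thus become limits in [v]. *)
Lemma cvg_mincrements u :
  expR (v - u) @[v --> within log_domain u^'] `=>` mincrements I (expR u).
Proof.
move=> P; rewrite /mincrements /= => IP.
have c : expR (v - u) @[v --> u] --> (1 : R).
  rewrite -expR0 -[X in expR X](subrr u).
  apply: (@continuous_comp _ _ _ (fun v => v - u) expR).
    by apply: cvgB; [exact: cvg_id|exact: cvg_cst].
  exact: continuous_expR.
move: (c _ IP); rewrite /= /within /dnbhs /within /=.
apply: (@filterS _ (nbhs u)) => v /= h vu Iv; apply: h => //.
  by rewrite /star0 -expR0 (inj_eq (@expR_inj R)) subr_eq0.
by rewrite /madd !expRK addrC subrK.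
Qed.

(** For [h = expR (v - u)] the logarithm of the multiplicative quotient is the ordinary difference
    quotient of [ln (f (expR v))]. As the limit [l] is positive, [ln] is continuous there. *)
Lemma mderiv_deriv_within (f : R -> R) u : log_domain u ->
  (forall s, I s -> 0 < f s) -> mderivable I f (expR u) ->
  0 < mderiv I f (expR u) /\
  deriv_within log_domain (fun v => ln (f (expR v))) u
               (ln (mderiv I f (expR u))).
Proof.
move=> Iu f_pos [l l0 fl].
have Fproper := within_dnbhs_proper log_domain_interval
  log_domain_nondegenerate Iu.
(* Properness passes from the image filter to the coarser [mincrements]; it identifies the value of
   [lim] with [l]. *)
have Gproper : ProperFilter (mincrements I (expR u)).
  split; last exact: within_filter.
  by move=> /cvg_mincrements; exact: filter_not_empty.
have -> : mderiv I f (expR u) = l by exact: cvg_lim fl.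
split=> //.
have h := cvg_comp _ _ (cvg_comp _ _ (@cvg_mincrements u) fl)
  (continuous_ln l0).
apply: cvg_trans h; apply: near_eq_cvg; apply: nearW => v /=.
by rewrite /mquotient /mdiv /msub /madd !expRK [u + _]addrC subrK.
Qed.

End LogarithmicCoordinates.

(** * Logarithms of inner products and norms *)

Section MultiplicativeNorm.
Context {R : realType}.
Implicit Types x y : 'rV[R]_3.

Lemma ln_minner x y : ln (minner x y) = \sum_(i < 3) ln (x 0 i) * ln (y 0 i).
Proof. exact: expRK. Qed.

Lemma minnerK x y : expR (ln (minner x y)) = minner x y.
Proof. by rewrite ln_minner. Qed.

Lemma ln_minner_ge0 x : 0 <= ln (minner x x).
Proof. by rewrite ln_minner; apply: sumr_ge0 => i _; rewrite -expr2 sqr_ge0. Qed.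

Lemma sqr_ln_mnorm x : ln (mnorm x) ^+ 2 = ln (minner x x).
Proof. by rewrite expRK sqr_sqrtr// ln_minner_ge0. Qed.

Lemma ln_minner_mvdiv x y a : ln (minner x (mvdiv y a)) = ln (minner x y) / ln a.
Proof.
rewrite !ln_minner mulr_suml; apply: eq_bigr => i _.
by rewrite mxE expRK mulrA.
Qed.

End MultiplicativeNorm.

(** * Transfer to multiplicative curves *)

Lemma msqr_madd_quadratic (R : realType) (r s c d : R) :
  msqr r = madd (madd (msqr s) (mmul (expR c) s)) (expR d) <->
  ln r ^+ 2 = ln s ^+ 2 + c * ln s + d.
Proof.
rewrite /msqr /madd /mmul !expRK.
by split=> [/expR_inj|->].
Qed.

Theorem proposition4p3 (R : realType) (I : set R) (x : R -> 'rV[R]_3)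
  (I_itv : is_interval I)
  (I_nondegenerate : exists a b, [/\ I a, I b & a < b])
  (I_pos : forall s, I s -> 0 < s)
  (x_pos : forall s, I s -> forall i, 0 < x s 0 i)
  (x_derivable : forall i, mderivable_n 2 I (fun s => x s 0 i))
  (x_arc_length : arc_length_parametrized I x)
  (x_biregular : mbiregular I x)
  (x_curvature : forall s, I s -> star0 < mcurvature I x s) :
  [/\ mrectifying I x ->
        exists c d : R, 0 < d /\ forall s, I s ->
          msqr (mdistance x s) =
          madd (madd (msqr s) (mmul (expR c) s)) (expR d),
      (exists c d : R, 0 < d /\ forall s, I s ->
          msqr (mdistance x s) =
          madd (madd (msqr s) (mmul (expR c) s)) (expR d)) ->
        mrectifying I x
    & forall c d s : R, I s ->
        (msqr (mdistance x s) =
         madd (madd (msqr s) (mmul (expR c) s)) (expR d)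
         <->
         expR (ln (mdistance x s) ^+ 2) =
         expR (ln s ^+ 2 + c * ln s + d))].
Proof.
pose J := log_domain I.
pose ln_coord (z : R -> 'rV[R]_3) (i : 'I_3) u := ln (z (expR u) 0 i).
pose y := ln_coord x.
pose y1 := ln_coord (mvderiv I x).
pose y2 := ln_coord (mvderiv I (mvderiv I x)).
have lnK_I s : I s -> expR (ln s) = s by move=> Is; rewrite lnK// posrE I_pos.
have Jitv : is_interval J := log_domain_interval I_itv.
have Jnd : nondegenerate J := log_domain_nondegenerate I_nondegenerate I_pos.
have Jln s : I s -> J (ln s) := log_domain_ln I_pos (s := s).
have mderiv_coord (z : R -> 'rV[R]_3) i s : mderiv I (fun u => z u 0 i) s = mvderiv I z s 0 i.
  by rewrite mxE.
have mderivP := mderiv_deriv_within I_itv I_nondegenerate I_pos.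
(* Positivity of the first derivative is kept because the next step differentiates its logarithm. *)
have x1 u i : J u ->
    0 < mvderiv I x (expR u) 0 i /\ deriv_within J (y i) u (y1 i u).
  move=> Ju; rewrite /y1 /ln_coord -mderiv_coord; apply: mderivP => //.
    by move=> s /x_pos.
  by have := @x_derivable i 0 isT _ Ju.
have x2 u i : J u -> deriv_within J (y1 i) u (y2 i u).
  move=> Ju; rewrite /y2 /ln_coord -mderiv_coord.
  apply: (proj2 (mderivP _ _ Ju _ _)) => [s Is|].
    by rewrite -(lnK_I s Is); have [] := x1 _ i (Jln s Is).
  (* The first iterate of the coordinatewise derivative is a coordinate of [mvderiv I x]. *)
  have := @x_derivable i 1 isT _ Ju.
  rewrite /= (_ : mderiv I _ = fun s => mvderiv I x s 0 i)//.
  by apply/funext => s; exact: mderiv_coord.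
have dotE z w s : I s -> dot (ln_coord z) (ln_coord w) (ln s) =
    ln (minner (z s) (w s)).
  move=> Is; rewrite ln_minner; apply: eq_bigr => i _.
  by rewrite /ln_coord lnK_I.
have on_J (P : R -> Prop) : (forall s, I s -> P (ln s)) -> forall u, J u -> P u.
  by move=> IP u /IP; rewrite expRK.
have y1_unit u : J u -> dot y1 y1 u = 1.
  move: u; apply: on_J => s Is.
  by rewrite dotE// -sqr_ln_mnorm x_arc_length// /star1 expRK expr1n.
have curv_gt0 s : I s -> 0 < ln (mcurvature I x s).
  by move=> Is; rewrite ln_gt0// x_curvature.
(* In logarithms the normal is the second derivative divided by [ln (mcurvature I x s)], which is
   positive, so orthogonality to either is the same condition. *)
have rectE s : I s ->
    minner (x s) (mnormal I x s) = star0 <-> dot y y2 (ln s) = 0.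
  move=> Is; rewrite dotE//.
  have nE : ln (minner (x s) (mnormal I x s)) =
      ln (minner (x s) (mvderiv I (mvderiv I x) s)) / ln (mcurvature I x s).
    exact: ln_minner_mvdiv.
  split=> r.
    move/eqP: nE; rewrite r ln1 eq_sym mulf_eq0 invr_eq0.
    by rewrite (gt_eqF (curv_gt0 s Is)) orbF => /eqP.
  by rewrite -minnerK nE r mul0r expR0.
have distE s : I s -> ln (mdistance x s) ^+ 2 = dot y y (ln s).
  by move=> Is; rewrite dotE// sqr_ln_mnorm.
split.
- move=> rect.
  have [||c [d [d0 yyE]]] := rectifying_dot_quadratic Jitv Jnd
    (fun u Ju i => proj2 (x1 u i Ju)) (fun u Ju i => x2 u i Ju) y1_unit.
  (* Here [dot y2 y2] is the square of the logarithm of the curvature. *)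
  + apply: on_J => s Is; rewrite dotE// -sqr_ln_mnorm.
    by rewrite expf_neq0// gt_eqF// curv_gt0.
  + by apply: on_J => s Is; apply/rectE => //; exact: rect.
  exists c, d; split=> // s Is; apply/msqr_madd_quadratic.
  by rewrite distE// yyE//; exact: Jln.
- move=> [c [d [_ xE]]] s Is; apply/rectE => //.
  apply: (dot_quadratic_rectifying Jitv Jnd
    (fun u Ju i => proj2 (x1 u i Ju)) (fun u Ju i => x2 u i Ju) y1_unit
    (c := c) (d := d)); last exact: Jln.
  by apply: on_J => t It; rewrite -distE//; apply/msqr_madd_quadratic/xE.
- move=> c d s _; split=> [/msqr_madd_quadratic ->//|/expR_inj].
  by move/msqr_madd_quadratic.
Qed.
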